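(* Let $Q\subset\mathbb{R}^d$ be a compact convex set, let $L_0,L_1>0$, and let $f:\mathbb{R}^d\to\mathbb{R}$ be a convex $(L_0,L_1)$-smooth function. Let $x^*\in\arg\min_{x\in Q}f(x)$ and $f^*=f(x^* )$. Assume that $f$ satisfies the Polyak--Łojasiewicz condition with constant $\mu>0$, i.e. $\frac12\|\nabla f(x)\|^2\ge\mu\,(f(x)-f^* )$ for all $x$, and that there exists $r>0$ such that $B(x^*,r)\subseteq Q$. Let $D=\max_{x,y\in Q}\|x-y\|$ and let $x_0,x_1,\dots$ be generated by the $(L_0,L_1)$-Frank--Wolfe algorithm with parameters $L_0,L_1$ from a starting point $x_0\in Q$. Then for every $k\ge0$, $$f(x_{k+1})-f^*\le (f(x_0)-f^* )\,\max\left\{\frac12,\,1-\frac{r}{4eL_1D^2}\right\}^{T}\max\left\{\frac12,\,1-\frac{r^2\mu}{2eL_0D^2}\right\}^{K},$$ where $T$ is the number of iterations $i\in\{0,\dots,k\}$ with $L_0\le L_1\|\nabla f(x_i)\|$ and $K$ is the number of iterations $i\in\{0,\dots,k\}$ with $L_0> L_1\|\nabla f(x_i)\|$.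
   Context: $\|\cdot\|$ is the Euclidean norm; $e=\exp(1)$; $B(x,r)=\{z:\|z-x\|\le r\}$. $(L_0,L_1)$-smoothness: a differentiable $f:\mathbb{R}^d\to\mathbb{R}$ is $(L_0,L_1)$-smooth ($L_0,L_1>0$) if for all $x,y\in\mathbb{R}^d$ with $\|x-y\|\le 1/L_1$ one has $\|\nabla f(x)-\nabla f(y)\|\le (L_0+L_1\|\nabla f(y)\|)\|x-y\|$. $(L_0,L_1)$-Frank--Wolfe algorithm: for $k=0,1,\dots$, choose any $s_k\in\arg\min_{z\in Q}\nabla f(x_k)^\top z$, set $d_k=s_k-x_k$, $$\alpha_k=\min\left\{1,\ \frac{-\nabla f(x_k)^\top d_k}{(L_0+L_1\|\nabla f(x_k)\|)\,\|d_k\|^2\,e}\right\},\qquad x_{k+1}=x_k+\alpha_kd_k,$$ with the convention $\alpha_k=1$ (so $x_{k+1}=x_k$) if $d_k=0$. *)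

(* Defs.v *)
From mathcomp Require Import all_boot all_order all_algebra.
From mathcomp Require Import all_classical all_reals all_analysis.
Set Implicit Arguments.
Unset Strict Implicit.
Unset Printing Implicit Defensive.
Import Order.TTheory GRing.Theory Num.Theory.
Import numFieldNormedType.Exports.
Local Open Scope classical_set_scope.
Local Open Scope ring_scope.

Definition dot (R : realType) (d : nat) (u v : 'rV[R]_d) : R :=
  \sum_(i < d) u 0 i * v 0 i.

(* The library norm `|x| on 'rV[R]_d is the sup norm; it defines the same
   topology, and the same notion of differentiability, as [enorm]. *)
Definition enorm (R : realType) (d : nat) (u : 'rV[R]_d) : R :=
  Num.sqrt (dot u u).

Definition eball (R : realType) (d : nat) (x : 'rV[R]_d) (r : R) :
  set 'rV[R]_d := [set z | enorm (z - x) <= r].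

(* Row of partial derivatives; it is the gradient wherever f is
   differentiable. *)
Definition grad (R : realType) (d : nat) (f : 'rV[R]_d -> R) (x : 'rV[R]_d) :
  'rV[R]_d := \row_(i < d) 'D_(delta_mx 0 i) f x.

Definition argmin (R : realType) (T : Type) (A : set T) (g : T -> R) : set T :=
  [set z | A z /\ forall y, A y -> g z <= g y].

Definition is_max (R : realType) (A : set R) (m : R) : Prop :=
  A m /\ ubound A m.

Definition L0L1_smooth (R : realType) (d : nat) (L0 L1 : R)
    (f : 'rV[R]_d -> R) : Prop :=
  (forall x : 'rV[R]_d, differentiable f x) /\
  (forall x y : 'rV[R]_d, enorm (x - y) <= 1 / L1 ->
     enorm (grad f x - grad f y)
       <= (L0 + L1 * enorm (grad f y)) * enorm (x - y)).

Definition PL_condition (R : realType) (d : nat) (mu fstar : R)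
    (f : 'rV[R]_d -> R) : Prop :=
  forall x, 1 / 2 * enorm (grad f x) ^+ 2 >= mu * (f x - fstar).

(* Here v is the Frank-Wolfe direction s - x at x. *)
Definition fw_stepsize (R : realType) (d : nat) (L0 L1 : R)
    (f : 'rV[R]_d -> R) (x v : 'rV[R]_d) : R :=
  if v == 0 then 1
  else Num.min 1
         (- dot (grad f x) v /
          ((L0 + L1 * enorm (grad f x)) * enorm v ^+ 2 * expR 1)).

(* [s] records the choices made among the solutions of the linear
   subproblems. *)
Definition fw_iterates (R : realType) (d : nat) (L0 L1 : R)
    (f : 'rV[R]_d -> R) (Q : set 'rV[R]_d) (x s : nat -> 'rV[R]_d) : Prop :=
  forall k : nat,
    argmin Q (dot (grad f (x k))) (s k) /\
    x k.+1 = x k + fw_stepsize L0 L1 f (x k) (s k - x k) *: (s k - x k).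

(* Main.v *)
Require Import Defs.
From mathcomp Require Import all_boot all_order all_algebra.
From mathcomp Require Import all_classical all_reals all_analysis.
From mathcomp Require Import ring lra.
Import Order.TTheory GRing.Theory Num.Theory.
Import numFieldNormedType.Exports.
Local Open Scope classical_set_scope.
Local Open Scope ring_scope.

(** With [g = grad f x], [a = L0 + L1 * enorm g], [v = s - x] and
    [G = - dot g v], the function [f] is bounded above along the step by the
    quadratic model [f x - t * G + e * a * t ^+ 2 * enorm v ^+ 2 / 2], as long
    as the displacement [t * enorm v] is at most [1 / L1]
    ([smooth_convex_descent] and [e >= 2]). The step size
    minimises this model over [t] in [[0, 1]], and it satisfies the bound on
    the displacement because [G <= enorm g * enorm v] and
    [L1 * enorm g <= a]. So a step decreases [f] by at least [G / 2] if it is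
    truncated at [1], and by at least [G ^+ 2 / (2 * e * a * enorm v ^+ 2)]
    otherwise ([fw_step_progress]).

    On the other hand [G] dominates the gap [f x - f xstar] by convexity, and,
    because the linear subproblem may use the whole ball around [xstar], it
    even dominates the gap plus [r * enorm g] ([fw_slope_ge]). A truncated
    step therefore at least halves the gap. For the other steps, [G ^+ 2] is at least
    [gap * r * enorm g] and at least [(r * enorm g) ^+ 2]: the first bound is
    used when the term [L1 * enorm g] dominates [a], so that [enorm g] cancels,
    and the second one, together with the Polyak-Lojasiewicz inequality, when
    [L0] dominates. Either way the gap contracts by the announced factor
    ([fw_step_contracts]), and the theorem multiplies these factors. *)

(** * Euclidean structure on row vectors *)

Lemma dotC {R : realType} {d} (u v : 'rV[R]_d) : dot u v = dot v u.
Proof. by apply: eq_bigr => i _; rewrite mulrC. Qed.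

Lemma dotDr {R : realType} {d} (u v w : 'rV[R]_d) :
  dot u (v + w) = dot u v + dot u w.
Proof. by rewrite -big_split; apply: eq_bigr => i _; rewrite mxE mulrDr. Qed.

Lemma dotZr {R : realType} {d} c (u v : 'rV[R]_d) :
  dot u (c *: v) = c * dot u v.
Proof. by rewrite mulr_sumr; apply: eq_bigr => i _; rewrite mxE mulrCA. Qed.

Lemma dotNr {R : realType} {d} (u v : 'rV[R]_d) : dot u (- v) = - dot u v.
Proof. by rewrite -scaleN1r dotZr mulN1r. Qed.

Lemma dotBr {R : realType} {d} (u v w : 'rV[R]_d) :
  dot u (v - w) = dot u v - dot u w.
Proof. by rewrite dotDr dotNr. Qed.

Lemma dotBl {R : realType} {d} (u v w : 'rV[R]_d) :
  dot (u - v) w = dot u w - dot v w.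
Proof. by rewrite dotC dotBr ![dot w _]dotC. Qed.

Lemma dot0r {R : realType} {d} (u : 'rV[R]_d) : dot u 0 = 0.
Proof. by rewrite -(scale0r 0) dotZr mul0r. Qed.

Lemma dot_ge0 {R : realType} {d} (u : 'rV[R]_d) : 0 <= dot u u.
Proof. by apply: sumr_ge0 => i _; rewrite -expr2 sqr_ge0. Qed.

Lemma enorm_ge0 {R : realType} {d} (u : 'rV[R]_d) : 0 <= enorm u.
Proof. exact: sqrtr_ge0. Qed.

Lemma enorm_sqr {R : realType} {d} (u : 'rV[R]_d) : enorm u ^+ 2 = dot u u.
Proof. by rewrite sqr_sqrtr// dot_ge0. Qed.

Lemma enorm_eq0 {R : realType} {d} (u : 'rV[R]_d) : enorm u = 0 -> u = 0.
Proof.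
move=> u0; have /eqP : dot u u = 0 by rewrite -enorm_sqr u0 expr0n.
rewrite psumr_eq0; last by move=> i _; rewrite -expr2 sqr_ge0.
move=> /allP du; apply/rowP => i; rewrite mxE.
by have := du i (mem_index_enum _); rewrite mulf_eq0 orbb => /eqP.
Qed.

Lemma enormZ {R : realType} {d} c (u : 'rV[R]_d) :
  0 <= c -> enorm (c *: u) = c * enorm u.
Proof.
move=> c0; rewrite /enorm dotZr dotC dotZr mulrA -expr2.
by rewrite sqrtrM ?sqr_ge0// sqrtr_sqr ger0_norm.
Qed.

Lemma enormN {R : realType} {d} (u : 'rV[R]_d) : enorm (- u) = enorm u.
Proof. by rewrite /enorm dotNr dotC dotNr opprK. Qed.

Lemma cauchy_schwarz {R : realType} {d} (u v : 'rV[R]_d) :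
  dot u v <= enorm u * enorm v.
Proof.
have [/enorm_eq0 ->|u0] := eqVneq (enorm u) 0.
  by rewrite dotC dot0r mulr_ge0 ?enorm_ge0.
have [/enorm_eq0 ->|v0] := eqVneq (enorm v) 0.
  by rewrite dot0r mulr_ge0 ?enorm_ge0.
have uv : 0 < enorm u * enorm v by rewrite mulr_gt0// lt0r ?u0 ?v0 enorm_ge0.
have := dot_ge0 (enorm v *: u - enorm u *: v).
rewrite dotBr !dotBl !dotZr ![dot (_ *: _) _]dotC !dotZr -!enorm_sqr [dot v u]dotC.
rewrite (_ : _ - _ = 2 * (enorm u * enorm v) * (enorm u * enorm v - dot u v)).
  by rewrite pmulr_rge0 ?subr_ge0// mulr_gt0.
ring.
Qed.

(** * First-order inequality for convex functions *)

Lemma derive_dot_grad {R : realType} {d} {f : 'rV[R]_d -> R} {x} v :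
  differentiable f x -> 'D_v f x = dot (grad f x) v.
Proof.
move=> df; rewrite deriveE// {1}[v]row_sum_delta linear_sum.
apply: eq_bigr => i _; rewrite linearZ mxE mulrC.
by rewrite deriveE.
Qed.

(** The difference quotient of [f] at [x] along [z - x] is at most [f z - f x]
    for every increment in [(0, 1]]; its limit at [0] from the right is the
    directional derivative. *)
Lemma convex_grad_le {R : realType} {d} {f : 'rV[R]_d -> R} x z :
  convex_function setT f -> differentiable f x ->
  dot (grad f x) (z - x) <= f z - f x.
Proof.
move=> cf df; rewrite -derive_dot_grad//.
pose q h := h^-1 *: ((f \o shift x) (h *: (z - x)) - f x).
have dv : q @ 0^' --> 'D_(z - x) f x by exact: diff_derivable.
have {}dv : q @ 0^'+ --> 'D_(z - x) f x.
  apply: cvg_trans dv; apply: cvg_app.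
  by apply: within_subset => h /=; rewrite lt_neqAle eq_sym => /andP[].
apply: (cvgr_to_le dv); near=> h.
have h0 : 0 < h by near: h; exact: nbhs_right_gt.
have h1 : h <= 1 by near: h; exact: nbhs_right_le.
have := cf (Itv01 (ltW h0) h1) z x (mem_set I) (mem_set I).
rewrite convRE /conv/= /unstable.onem => cfh.
rewrite /q /GRing.scale/= mulrC ler_pdivrMr//.
have -> : h *: (z - x) + x = h *: z + (1 - h) *: x.
  by rewrite scalerBr scalerBl scale1r addrAC addrA.
by move: cfh; set w := f (_ + _) => cfh; lra.
Unshelve. all: by end_near. Qed.

(** * One Frank-Wolfe step *)

(** Convexity bounds the increment by the slope at the end point [x + v], and
    smoothness compares that slope with the one at [x]. The quadratic term is
    twice the one given by integrating the gradient along the segment; the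
    factor [e >= 2] in the step size absorbs this loss. *)
Lemma smooth_convex_descent {R : realType} {d} {L0 L1 : R}
    {f : 'rV[R]_d -> R} (x v : 'rV[R]_d) :
  convex_function setT f -> L0L1_smooth L0 L1 f -> enorm v <= 1 / L1 ->
  f (x + v) <= f x + dot (grad f x) v
               + (L0 + L1 * enorm (grad f x)) * enorm v ^+ 2.
Proof.
move=> cf [df sf] vL.
have xvE : x + v - x = v by rewrite addrAC subrr add0r.
have := convex_grad_le (x + v) x cf (df _).
rewrite -opprB xvE dotNr => slope_end.
have := sf (x + v) x; rewrite xvE => /(_ vL) gradB.
have := cauchy_schwarz (grad f (x + v) - grad f x) v.
rewrite dotBl => cs.
have := ler_wpM2r (enorm_ge0 v) gradB; rewrite -mulrA -expr2 => gradBv.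
lra.
Qed.

(** The step size minimises on [[0, 1]] the quadratic model whose curvature is
    [e / 2] times the one of [smooth_convex_descent]; since [e >= 2], the model
    majorises [f] at displacements of length at most [1 / L1]. If the minimum
    is interior, its value gives the second bound. If it is at [1], the slope
    [G] is at least the curvature times [enorm v ^+ 2], so that the quadratic
    term takes back at most [G / 2]. *)
Lemma fw_step_progress {R : realType} {d} {L0 L1 : R}
    {f : 'rV[R]_d -> R} {x v : 'rV[R]_d} :
  0 < L0 -> 0 < L1 -> convex_function setT f -> L0L1_smooth L0 L1 f ->
  v != 0 -> dot (grad f x) v <= 0 ->
  let G := - dot (grad f x) v in
  let x' := x + fw_stepsize L0 L1 f x v *: v in
  f x' <= f x - G / 2 \/
  f x' <= f x - G ^+ 2 /
    (2 * expR 1 * (L0 + L1 * enorm (grad f x)) * enorm v ^+ 2).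
Proof.
move=> L0_gt0 L1_gt0 cf sf v0 gv_le0 G; rewrite /fw_stepsize (negPf v0).
set g := grad f x; set a := L0 + _; set n := enorm v; set e := expR 1.
have e2 : 2 <= e by have := expR_ge1Dx (1 : R); rewrite -/e; lra.
have n_gt0 : 0 < n.
  by rewrite lt0r enorm_ge0 andbT; apply: contra_neq v0; exact: enorm_eq0.
have L1g_ge0 : 0 <= L1 * enorm g by rewrite mulr_ge0 ?enorm_ge0// ltW.
have a_gt0 : 0 < a by rewrite /a; lra.
have an_gt0 : 0 < a * n ^+ 2 by rewrite mulr_gt0 ?exprn_gt0.
have ane_gt0 : 0 < a * n ^+ 2 * e by rewrite mulr_gt0//; lra.
have G_ge0 : 0 <= G by rewrite oppr_ge0.
have GE : G / (a * n ^+ 2 * e) * (a * n ^+ 2 * e) = G.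
  by rewrite mulfVK// gt_eqF.
set t0 := G / _ in GE *; set t := Num.min 1 t0.
have t0_ge0 : 0 <= t0 by rewrite divr_ge0// ltW.
have t_ge0 : 0 <= t by rewrite le_min ler01.
have t_le : t <= t0 by rewrite ge_min lexx orbT.
(* The displacement is at most [G / (e * a * n) <= enorm g / a <= 1 / L1]. *)
have short : enorm (t *: v) <= 1 / L1.
  rewrite enormZ// -/n ler_pdivlMr//.
  suff : t0 * n * L1 <= 1.
    by apply: le_trans; rewrite ler_wpM2r ?ler_wpM2r// ltW.
  have cs : G <= enorm g * n.
    by have := cauchy_schwarz g (- v); rewrite dotNr enormN.
  have Gan : G * L1 <= a * n.
    have := ler_wpM2r (ltW L1_gt0) cs.
    have := mulr_gt0 L0_gt0 n_gt0.
    rewrite /a; lra.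
  rewrite -(@ler_pM2r _ (a * n))// ?mulr_gt0//.
  have t0E : t0 * n * L1 * (a * n) * e = G * L1 by rewrite -[in RHS]GE; ring.
  have w_ge0 : 0 <= t0 * n * L1 * (a * n)
    by do ?[exact: t0_ge0 | exact: ltW | apply: mulr_ge0].
  have := ler_wpM2l w_ge0 e2; rewrite t0E mul1r.
  lra.
have := smooth_convex_descent x (t *: v) cf sf short.
rewrite dotZr enormZ// -/n -/g -/a exprMn.
rewrite -[dot g v]opprK -/G => descent.
have [t0_ge1|t0_lt1] := leP 1 t0.
  left; move: descent; rewrite /t (min_idPl t0_ge1) expr1n !mul1r => descent.
  have : 2 * (a * n ^+ 2) <= G.
    rewrite -GE mulrC [leRHS]mulrCA ler_wpM2l ?(ltW an_gt0)//; nra.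
  lra.
right; move: descent; rewrite /t (min_idPr (ltW t0_lt1)) => descent.
have -> : G ^+ 2 / (2 * e * a * n ^+ 2) = t0 * G / 2.
  rewrite /t0; field.
  by rewrite !gt_eqF//; lra.
have : 2 * (a * (t0 ^+ 2 * n ^+ 2)) <= t0 * G.
  rewrite -[in leRHS]GE.
  have : 0 <= t0 ^+ 2 * (a * n ^+ 2) by rewrite mulr_ge0 ?sqr_ge0// ltW.
  nra.
lra.
Qed.

(** The linear minimiser [s] does at least as well as the point of the ball
    farthest in the direction opposite to the gradient, which improves on the
    centre by [r * enorm (grad f x)]; convexity compares the centre with [x]. *)
Lemma fw_slope_ge {R : realType} {d} {Q : set 'rV[R]_d} {f : 'rV[R]_d -> R}
    {c x s : 'rV[R]_d} {r : R} :
  convex_function setT f -> differentiable f x -> 0 <= r ->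
  eball c r `<=` Q -> argmin Q (dot (grad f x)) s ->
  f x - f c + r * enorm (grad f x) <= - dot (grad f x) (s - x).
Proof.
move=> cf df r_ge0 ballQ [_ smin]; set g := grad f x in smin *.
have := convex_grad_le x c cf df; rewrite -/g !dotBr => fc.
(* If [g = 0] then [r / enorm g = 0], and the point below is the centre. *)
have q_ge0 : 0 <= r / enorm g by rewrite divr_ge0// enorm_ge0.
have zQ : Q (c - (r / enorm g) *: g).
  apply: ballQ; rewrite /eball/= addrAC subrr add0r enormN enormZ//.
  have [->|g0] := eqVneq (enorm g) 0; first by rewrite mulr0.
  by rewrite divfK.
have := smin _ zQ; rewrite dotBr dotZr -enorm_sqr.
have -> : r / enorm g * enorm g ^+ 2 = r * enorm g.
  have [->|g0] := eqVneq (enorm g) 0; first by rewrite expr0n/= !mulr0.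
  by rewrite expr2 mulrA divfK.
lra.
Qed.

Lemma fw_stepsize_itv {R : realType} {d} {L0 L1 : R} {f : 'rV[R]_d -> R}
    {x v : 'rV[R]_d} :
  0 <= L0 -> 0 <= L1 -> dot (grad f x) v <= 0 ->
  0 <= fw_stepsize L0 L1 f x v <= 1.
Proof.
move=> L0_ge0 L1_ge0 gv; rewrite /fw_stepsize; case: ifP => _.
  by rewrite ler01 lexx.
rewrite le_min ler01 ge_min lexx/= andbT divr_ge0 ?oppr_ge0//.
by rewrite !mulr_ge0 ?addr_ge0 ?mulr_ge0 ?enorm_ge0 ?expR_ge0 ?sqr_ge0.
Qed.

Lemma convex_set_segment {R : realType} {d} {Q : set 'rV[R]_d}
    {x s : 'rV[R]_d} {t : R} :
  convex_set Q -> Q x -> Q s -> 0 <= t <= 1 -> Q (x + t *: (s - x)).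
Proof.
move=> Qc Qx Qs /andP[t0 t1].
have := Qc s x (Itv01 t0 t1) (mem_set Qs) (mem_set Qx).
move=> /set_mem; rewrite /conv/= /unstable.onem.
by rewrite scalerBr scalerBl scale1r addrCA addrC -addrA [- _ + _]addrC addrA.
Qed.

Lemma ler_div_cross {R : realType} {y P S M c : R} :
  0 <= y -> 0 < P -> 0 < M -> M <= c * P -> y * c <= S -> y / P <= S / M.
Proof.
move=> y0 P0 M0 McP ycS; rewrite ler_pdivrMr// mulrAC ler_pdivlMr//.
apply: le_trans (ler_wpM2l y0 McP) _.
by rewrite mulrA ler_wpM2r// ltW.
Qed.

(** When [L0 <= L1 * enorm g], the curvature [L0 + L1 * enorm g] is at most
    [2 * L1 * enorm g]; one factor of the squared slope is bounded below by the
    gap and the other by [r * enorm g], and [enorm g] cancels. Otherwise the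
    curvature is at most [2 * L0], both factors are bounded below by
    [r * enorm g], and the Polyak-Lojasiewicz inequality brings the gap back. *)
Lemma fw_step_contracts {R : realType} {d} {Q : set 'rV[R]_d}
    {L0 L1 mu r D : R} {f : 'rV[R]_d -> R} {xstar x s : 'rV[R]_d} :
  0 < L0 -> 0 < L1 -> convex_function setT f -> L0L1_smooth L0 L1 f ->
  PL_condition mu (f xstar) f -> 0 <= mu -> 0 <= r ->
  eball xstar r `<=` Q -> f xstar <= f x ->
  enorm (s - x) <= D -> argmin Q (dot (grad f x)) s ->
  f (x + fw_stepsize L0 L1 f x (s - x) *: (s - x)) - f xstar <=
    (if L0 <= L1 * enorm (grad f x)
     then Num.max (1 / 2) (1 - r / (4 * expR 1 * L1 * D ^+ 2))
     else Num.max (1 / 2) (1 - r ^+ 2 * mu / (2 * expR 1 * L0 * D ^+ 2)))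
    * (f x - f xstar).
Proof.
move=> L0_gt0 L1_gt0 cf sf pl mu_ge0 r_ge0 ballQ; rewrite -subr_ge0.
move=> gap_ge0 vD smin.
have slope := fw_slope_ge cf (sf.1 x) r_ge0 ballQ smin.
set rate := (X in _ <= X * _); set v := s - x in vD slope *.
have rg_ge0 : 0 <= r * enorm (grad f x) by rewrite mulr_ge0 ?enorm_ge0.
(* A zero direction forces a zero gap, through the slope bound. *)
have [v0|v0] := eqVneq v 0.
  move: slope; rewrite v0 dot0r oppr0 => slope.
  have gap0 : f x - f xstar = 0 by lra.
  by rewrite scaler0 addr0 gap0 mulr0.
have n_gt0 : 0 < enorm v.
  by rewrite lt0r enorm_ge0 andbT; apply: contra_neq v0; exact: enorm_eq0.
have D_gt0 : 0 < D by exact: lt_le_trans vD.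
have nD2 : enorm v ^+ 2 <= D ^+ 2 by rewrite ler_sqr ?nnegrE// ltW.
have D2_gt0 : 0 < D ^+ 2 by rewrite exprn_gt0.
have gv_le0 : dot (grad f x) v <= 0 by lra.
have := fw_step_progress L0_gt0 L1_gt0 cf sf v0 gv_le0.
set x' := x + _; move: slope.
set G := - dot _ _; set g := grad f x in rg_ge0 *.
set gap := f x - f xstar in gap_ge0 * => slope /=.
have gapG : gap <= G by lra.
have rgG : r * enorm g <= G by lra.
set M := 2 * _ * _ * _; case=> [halved | progress].
  apply: (@le_trans _ _ (1 / 2 * gap)); first by rewrite /gap in gapG *; lra.
  by rewrite ler_wpM2r// /rate; case: ifP => _; rewrite le_max lexx.
have e_gt0 := expR_gt0 (1 : R).
have a_gt0 : 0 < L0 + L1 * enorm g by rewrite ltr_pwDl// mulr_ge0 ?enorm_ge0// ltW.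
have M_gt0 : 0 < M by rewrite !mulr_gt0// exprn_gt0.
have M_le b : L0 + L1 * enorm g <= b -> M <= 2 * expR 1 * b * D ^+ 2.
  by move=> ab; rewrite ler_pM// ?sqr_ge0 ?ler_wpM2l// ltW// !mulr_gt0.
suff [q qgap qrate] : exists2 q, q * gap <= G ^+ 2 / M & 1 - q <= rate.
  apply: le_trans (ler_wpM2r gap_ge0 qrate).
  by rewrite mulrBl mul1r /gap in qgap *; lra.
rewrite /rate; case: ifP => [large|/negbT].
- exists (r / (4 * expR 1 * L1 * D ^+ 2)); last by rewrite le_max lexx orbT.
  rewrite mulrAC; apply: (@ler_div_cross _ _ _ _ _ (enorm g)) => //.
  + by rewrite mulr_ge0.
  + by rewrite !mulr_gt0.
  + have -> : enorm g * (4 * expR 1 * L1 * D ^+ 2) =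
      2 * expR 1 * (2 * (L1 * enorm g)) * D ^+ 2 by ring.
    by apply: M_le; lra.
  + rewrite mulrAC expr2; exact: ler_pM.
- rewrite -ltNge => small.
  exists (r ^+ 2 * mu / (2 * expR 1 * L0 * D ^+ 2)).
    rewrite mulrAC; apply: (@ler_div_cross _ _ _ _ _ 2) => //.
    + by rewrite !mulr_ge0// sqr_ge0.
    + by rewrite !mulr_gt0.
    + have -> : 2 * (2 * expR 1 * L0 * D ^+ 2) =
        2 * expR 1 * (2 * L0) * D ^+ 2 by ring.
      by apply: M_le; lra.
    + apply: (@le_trans _ _ ((r * enorm g) ^+ 2)); last first.
        by rewrite ler_sqr ?nnegrE// (le_trans rg_ge0).
      rewrite exprMn.
      by have := ler_wpM2l (sqr_ge0 r) (pl x); rewrite -/g -/gap; lra.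
  by rewrite le_max lexx orbT.
Qed.

Lemma prodr_two_rates {R : comPzRingType} (n : nat) (P : pred nat) (a b : R) :
  \prod_(i < n) (if P i then a else b) =
  a ^+ #|[pred i : 'I_n | P i]| * b ^+ #|[pred i : 'I_n | ~~ P i]|.
Proof. by rewrite big_if/= !prodr_const. Qed.

(** * Linear convergence *)

Theorem theorem2 (R : realType) (d : nat) (Q : set 'rV[R]_d)
  (L0 L1 mu r D : R) (f : 'rV[R]_d -> R) (xstar : 'rV[R]_d)
  (x s : nat -> 'rV[R]_d)
  (Qcompact : compact Q) (Qconvex : convex_set Q)
  (L0_gt0 : 0 < L0) (L1_gt0 : 0 < L1)
  (fconvex : convex_function setT f)
  (fsmooth : L0L1_smooth L0 L1 f)
  (xstar_min : argmin Q f xstar)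
  (mu_gt0 : 0 < mu) (fPL : PL_condition mu (f xstar) f)
  (r_gt0 : 0 < r) (ballQ : eball xstar r `<=` Q)
  (D_max : is_max [set enorm (y - z) | y in Q & z in Q] D)
  (x0Q : Q (x 0%N)) (FW : fw_iterates L0 L1 f Q x s) :
  forall k : nat,
    let T := #|[pred i : 'I_k.+1 | L0 <= L1 * enorm (grad f (x i))]| in
    let K := #|[pred i : 'I_k.+1 | L0 > L1 * enorm (grad f (x i))]| in
    f (x k.+1) - f xstar <=
      (f (x 0%N) - f xstar)
      * Num.max (1 / 2) (1 - r / (4 * expR 1 * L1 * D ^+ 2)) ^+ T
      * Num.max (1 / 2) (1 - r ^+ 2 * mu / (2 * expR 1 * L0 * D ^+ 2)) ^+ K.
Proof.
move=> k; cbv zeta.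
have iterQ j : Q (x j).
  elim: j => [//|j Qxj]; have [smin ->] := FW j.
  apply: convex_set_segment => //; first exact: smin.1.
  apply: fw_stepsize_itv; [exact: ltW | exact: ltW | rewrite dotBr subr_le0].
  exact: smin.2.
pose rate i : R := if L0 <= L1 * enorm (grad f (x i))
  then Num.max (1 / 2) (1 - r / (4 * expR 1 * L1 * D ^+ 2))
  else Num.max (1 / 2) (1 - r ^+ 2 * mu / (2 * expR 1 * L0 * D ^+ 2)).
have rate_ge0 i : 0 <= rate i.
  by rewrite /rate; case: ifP => _; rewrite le_max divr_ge0.
have step j : f (x j.+1) - f xstar <= rate j * (f (x j) - f xstar).
  have [smin ->] := FW j.
  apply: (fw_step_contracts L0_gt0 L1_gt0 fconvex fsmooth fPL
    (ltW mu_gt0) (ltW r_gt0) ballQ _ _ smin); first exact: xstar_min.2.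
  by apply: D_max.2; exists (s j); [exact: smin.1|exists (x j)].
have decay j : f (x j) - f xstar <= (f (x 0%N) - f xstar) * \prod_(i < j) rate i.
  elim: j => [|j IH]; first by rewrite big_ord0 mulr1.
  apply: le_trans (step j) _.
  by rewrite big_ord_recr/= mulrA mulrC ler_wpM2r.
apply: le_trans (decay _) _.
rewrite (prodr_two_rates _ (fun i => L0 <= L1 * enorm (grad f (x i)))) mulrA.
suff -> : #|[pred i : 'I_k.+1 | L1 * enorm (grad f (x i)) < L0]| =
  #|[pred i : 'I_k.+1 | ~~ (L0 <= L1 * enorm (grad f (x i)))]| by [].
by apply: eq_card => i; rewrite !inE ltNge.
Qed.
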